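(* Let $(H_m)$ be a $p$-family of complete graphs, let $(G_m)$ be a $p$-family of graphs, and let $f_m=\hat f_{G_m,H_m}(\bar Z,\bar Y)$ be the generalised homomorphism polynomial (over all homomorphisms from $G_m$ to $H_m$). (i) If $(G_m)$ has bounded tree-width, then $(f_m)\in\mathsf{VP}$. (ii) If $(G_m)$ has bounded path-width, then $(f_m)\in\mathsf{VBP}$.
   Context: For undirected graphs $G,H$, a homomorphism $G\to H$ is a map $V(G)\to V(H)$ sending edges to edges. With variables $Z_{u,a}$ ($u\in V(G)$, $a\in V(H)$) and $Y_{(a,b)}$ ($(a,b)\in E(H)$), the generalised homomorphism polynomial is $\hat f_{G,H}=\sum_{\phi}\big(\prod_{u\in V(G)}Z_{u,\phi(u)}\big)\big(\prod_{(u,v)\in E(G)}Y_{(\phi(u),\phi(v))}\big)$, the sum over all homomorphisms $\phi:G\to H$. A sequence of graphs is a $p$-family if the number of vertices of $G_m$ is polynomially bounded in $m$; it has bounded tree-width (path-width) if some constant bounds the tree-width (path-width) of every graph in it. A $p$-family of polynomials has polynomially bounded number of variables and degree. $\mathsf{VP}$: $p$-families computed by polynomial-size arithmetic circuits; $\mathsf{VBP}$: $p$-families computed by polynomial-size skew arithmetic circuits (at every $\times$ gate at most one input is the output of another gate). *)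

(* Defs.v *)
From HB Require Import structures.
From mathcomp Require Import all_boot all_order all_algebra.
From mathcomp Require Import mpoly.
From mathcomp Require Import zify.
Set Implicit Arguments. Unset Strict Implicit. Unset Printing Implicit Defensive.
Import GRing.Theory.
Local Open Scope ring_scope.

Record sgraph := SGraph {
  nv : nat;
  adj : rel 'I_nv;
  adj_sym : forall x y, adj x y = adj y x;
  adj_irr : irreflexive adj }.

Definition is_complete (H : sgraph) : Prop :=
  forall a b : 'I_(nv H), a != b -> adj a b.

Definition is_hom (G H : sgraph) (phi : {ffun 'I_(nv G) -> 'I_(nv H)}) : bool :=
  [forall u, forall v, adj u v ==> adj (phi u) (phi v)].

Definition is_tree (t : nat) (T : rel 'I_t) : Prop :=
  [/\ 0 < t, (forall x y, T x y = T y x), irreflexive T,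
      (forall i j, connect T i j) &
      (forall c : seq 'I_t, uniq c -> 3 <= size c -> ~~ cycle T c)]%N.

Definition is_decomposition (G : sgraph) (t : nat) (T : rel 'I_t)
    (B : 'I_t -> {set 'I_(nv G)}) (w : nat) : Prop :=
  [/\ (forall v, exists i, v \in B i),
      (forall u v, adj u v -> exists i, (u \in B i) && (v \in B i)),
      (forall v i j, v \in B i -> v \in B j ->
          connect [rel x y | [&& T x y, v \in B x & v \in B y]] i j) &
      (forall i, #|B i| <= w.+1)]%N.

Definition tw_le (G : sgraph) (w : nat) : Prop :=
  exists t (T : rel 'I_t) (B : 'I_t -> {set 'I_(nv G)}),
    is_tree T /\ is_decomposition T B w.

Definition path_rel (t : nat) : rel 'I_t :=
  fun i j => ((i.+1 == j) || (j.+1 == i))%N.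

Definition pw_le (G : sgraph) (w : nat) : Prop :=
  exists t (B : 'I_t -> {set 'I_(nv G)}), is_decomposition (@path_rel t) B w.

Definition bounded_tw (G : nat -> sgraph) : Prop :=
  exists w, forall m, tw_le (G m) w.
Definition bounded_pw (G : nat -> sgraph) : Prop :=
  exists w, forall m, pw_le (G m) w.

Definition poly_bounded (g : nat -> nat) : Prop :=
  exists c, forall m, (g m <= c + m ^ c)%N.

(* For n = |V(G)|, k = |V(H)| the polynomial lives in n*k + k*k        *)
(* variables: Z_{u,a} is variable u*k + a, and Y_{{a,b}} (for the      *)
(* unordered pair {a,b}) is variable n*k + (min a b)*k + max a b.      *)
Lemma zvar_proof n k (u : 'I_n) (a : 'I_k) : (u * k + a < n * k + k * k)%N.
Proof. have := ltn_ord u; have := ltn_ord a; nia. Qed.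

Lemma yvar_proof n k (a b : 'I_k) :
  (n * k + minn a b * k + maxn a b < n * k + k * k)%N.
Proof.
have := ltn_ord a; have := ltn_ord b.
case: (leqP a b) => h; rewrite ?(minn_idPl h) ?(maxn_idPr h);
  rewrite ?(minn_idPr (ltnW h)) ?(maxn_idPl (ltnW h)); nia.
Qed.

Definition zvar n k (u : 'I_n) (a : 'I_k) : 'I_(n * k + k * k) :=
  Ordinal (zvar_proof u a).
Definition yvar n k (a b : 'I_k) : 'I_(n * k + k * k) :=
  Ordinal (yvar_proof n a b).

Definition hom_nvars (G H : sgraph) : nat := (nv G * nv H + nv H * nv H)%N.

(* The generalised homomorphism polynomial hat f_{G,H}:
   sum over homomorphisms phi of
     prod_{u in V(G)} Z_{u, phi u} * prod_{{u,v} in E(G)} Y_{{phi u, phi v}}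
   (each undirected edge of G is listed once, as the pair (u,v) with u < v). *)
Definition hom_poly (R : comNzRingType) (G H : sgraph) : {mpoly R[hom_nvars G H]} :=
  \sum_(phi : {ffun 'I_(nv G) -> 'I_(nv H)} | is_hom phi)
    ((\prod_(u : 'I_(nv G)) 'X_(zvar u (phi u))) *
     (\prod_(p : 'I_(nv G) * 'I_(nv G) | ((p.1 < p.2)%N && adj p.1 p.2))
        'X_(yvar (nv G) (phi p.1) (phi p.2)))).

(* A gate over N variables with constants in R. GAdd i j / GMul i j take
   as inputs the outputs of the earlier gates number i and j. *)
Inductive gate (R : Type) (N : nat) :=
  | GVar of 'I_N
  | GConst of R
  | GAdd of nat & nat
  | GMul of nat & nat.

Definition is_leaf R N (g : gate R N) : bool :=
  match g with GVar _ | GConst _ => true | _ => false end.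

Definition gate_val (R : comNzRingType) N (vals : seq {mpoly R[N]}) (g : gate R N)
    : {mpoly R[N]} :=
  match g with
  | GVar i => 'X_i
  | GConst c => c%:MP
  | GAdd i j => nth 0 vals i + nth 0 vals j
  | GMul i j => nth 0 vals i * nth 0 vals j
  end.

Definition circ_vals (R : comNzRingType) N (C : seq (gate R N)) : seq {mpoly R[N]} :=
  foldl (fun vals g => rcons vals (gate_val vals g)) [::] C.

Definition wf_circuit R N (C : seq (gate R N)) : bool :=
  all (fun ig : nat * gate R N =>
         match ig.2 with
         | GAdd a b | GMul a b => (a < ig.1) && (b < ig.1)
         | _ => true end)%N (zip (iota 0 (size C)) C).

Definition skew_circuit R N (C : seq (gate R N)) : bool :=
  all (fun g : gate R N =>
         match g with
         | GMul a b => has (fun ig : nat * gate R N => (ig.1 == a) && is_leaf ig.2)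
                           (zip (iota 0 (size C)) C)
                    || has (fun ig : nat * gate R N => (ig.1 == b) && is_leaf ig.2)
                           (zip (iota 0 (size C)) C)
         | _ => true end)%N C.

Definition computes (R : comNzRingType) N (C : seq (gate R N)) (f : {mpoly R[N]}) :=
  [/\ wf_circuit C, (0 < size C)%N & last 0 (circ_vals C) = f].

Definition p_family (R : comNzRingType) (N : nat -> nat)
    (f : forall m, {mpoly R[N m]}) : Prop :=
  poly_bounded N /\ poly_bounded (fun m => msize (f m)).

Definition in_VP (R : comNzRingType) (N : nat -> nat) (f : forall m, {mpoly R[N m]}) :=
  p_family f /\
  exists c, forall m, exists C : seq (gate R (N m)),
      (size C <= c + m ^ c)%N /\ computes C (f m).

Definition in_VBP (R : comNzRingType) (N : nat -> nat) (f : forall m, {mpoly R[N m]}) :=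
  p_family f /\
  exists c, forall m, exists C : seq (gate R (N m)),
      [/\ (size C <= c + m ^ c)%N, skew_circuit C & computes C (f m)].

(* Main.v *)
(* The polynomial is a sum over all assignments phi of a product of local factors: Z_{u,phi(u)} for each vertex u, and for each edge {u,v} either Y_{{phi(u),phi(v)}} or 0. The vertices are summed out one at a time.

For tree-width, fix the chordal supergraph in which two vertices are adjacent when they share a bag. It has a perfect elimination order; summing out v multiplies the factors touching v and yields a factor on the later neighbours of v, which all lie in one bag, so it has at most |V(H)|^(w+1) distinct values.

For path-width, sum the vertices out in the order of their last bag, carrying a single accumulated factor; its scope always lies in the last bag of the current vertex, and it is only ever multiplied by variables and constants, which makes the circuit skew. *)

Require Import Defs.
From mathcomp Require Import all_boot all_order all_algebra.
From mathcomp Require Import mpoly.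
From mathcomp Require Import zify.
Set Implicit Arguments. Unset Strict Implicit. Unset Printing Implicit Defensive.
Import GRing.Theory.
Local Open Scope ring_scope.

(** * Closure properties of polynomially bounded functions *)

Section PolyBounded.
Local Open Scope nat_scope.

(** A single power of a base that is at least 2 absorbs additive constants, and sums and products
    then reduce to adding exponents. *)
Lemma poly_bounded_expP g :
  poly_bounded g <-> exists c, forall m, g m <= m.+2 ^ c.
Proof.
split=> -[c gle].
  exists c.+1 => m; apply: leq_trans (gle m) _.
  have c_lt : c < m.+2 ^ c by apply: ltn_expl.
  have mc : m ^ c <= m.+2 ^ c by case: (c) => // d; rewrite leq_exp2r //; lia.
  rewrite expnS; nia.
(* The summand [3 ^ c] covers [m <= 1]; for [m >= 2] one has [m + 2 <= m ^ 2], whence the exponent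
   [2 * c]. *)
exists (3 ^ c + 2 * c) => m; apply: leq_trans (gle m) _.
case: m => [|[|m]].
- by apply: leq_trans (leq_addr _ _); apply: leq_trans (leq_addr _ _); case: (c) => // d; rewrite leq_exp2r.
- by apply: leq_trans (leq_addr _ _); apply: leq_trans (leq_addr _ _).
apply: leq_trans (leq_addl _ _).
apply: (@leq_trans (m.+2 ^ (2 * c))); last by rewrite leq_pexp2l // leq_addl.
rewrite expnM; case: (c) => // d; rewrite leq_exp2r // expnS expn1; nia.
Qed.

Lemma poly_bounded_le g h :
  (forall m, g m <= h m) -> poly_bounded h -> poly_bounded g.
Proof. by move=> gh [c hc]; exists c => m; apply: leq_trans (gh m) (hc m). Qed.

Lemma poly_bounded_const a : poly_bounded (fun=> a).
Proof. by exists a => m; apply: leq_addr. Qed.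

Lemma poly_boundedD g h :
  poly_bounded g -> poly_bounded h -> poly_bounded (fun m => g m + h m).
Proof.
move=> /poly_bounded_expP[c gc] /poly_bounded_expP[d hd].
apply/poly_bounded_expP; exists (c + d).+1 => m.
have := gc m; have := hd m.
have : 0 < m.+2 ^ c by rewrite expn_gt0.
have : 0 < m.+2 ^ d by rewrite expn_gt0.
rewrite expnS expnD; nia.
Qed.

Lemma poly_boundedM g h :
  poly_bounded g -> poly_bounded h -> poly_bounded (fun m => g m * h m).
Proof.
move=> /poly_bounded_expP[c gc] /poly_bounded_expP[d hd].
apply/poly_bounded_expP; exists (c + d) => m.
by rewrite expnD leq_mul.
Qed.

Lemma poly_boundedX g e : poly_bounded g -> poly_bounded (fun m => g m ^ e).
Proof.
move=> gb; elim: e => [|e IHe]; first exact: poly_bounded_const.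
apply: poly_bounded_le (poly_boundedM gb IHe) => m; by rewrite expnS.
Qed.

End PolyBounded.

(** * Elimination orders from tree and path decompositions *)

Section Decomposition.

Lemma connect_crossing (T : finType) (e : rel T) (S : {set T}) i j :
  connect e i j -> i \in S -> j \notin S ->
  exists a b, [/\ e a b, a \in S & b \notin S].
Proof.
case/connectP=> p; elim: p i => [|x p IHp] i /= => [_ -> -> // | /andP[eix xp] jE iS jS].
have [xS|xS] := boolP (x \in S); last by exists i, x.
exact: IHp xp jE xS jS.
Qed.

Variables (n t : nat) (B : 'I_t -> {set 'I_n}) (w : nat).

(** Turns every bag into a clique, loops included, so that clique conditions can quantify over all
    pairs without [x != y]. *)
Definition share : rel 'I_n := fun u v => [exists i, (u \in B i) && (v \in B i)].

Hypothesis cover_bag : forall v, exists i, v \in B i.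
Hypothesis width : forall i, (#|B i| <= w.+1)%N.

Lemma share_refl u : share u u.
Proof. by have [i ui] := cover_bag u; apply/existsP; exists i; rewrite ui. Qed.

(** A perfect elimination order whose later neighbourhoods have at most the size of a bag. *)
Fixpoint elim_order (E : rel 'I_n) (r : seq 'I_n) : Prop :=
  if r is v :: r' then
    [/\ (#|[set u in r' | E v u]| <= w.+1)%N,
        {in [set u in r' | E v u] &, forall x y, E x y} & elim_order E r']
  else True.

Section Tree.
Variable T : rel 'I_t.
Hypothesis Tsym : forall x y, T x y = T y x.
Hypothesis Tacyc : forall c : seq 'I_t, uniq c -> (3 <= size c)%N -> ~~ cycle T c.
Hypothesis conn_bag : forall v i j, v \in B i -> v \in B j ->
  connect [rel x y | [&& T x y, v \in B x & v \in B y]] i j.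

(* [S] is a branch of the tree hanging at [y]: the recursion descends to the component of [S] minus [y] containing some occurrence set that avoids [y]; acyclicity makes that component a branch again. *)
Lemma simplicial_in_branch (U : {set 'I_n}) (S : {set 'I_t}) y :
  y \in S -> (forall a b, a \in S -> b \notin S -> T a b -> a = y) ->
  (exists2 v, v \in U & forall i, v \in B i -> i \in S) ->
  exists2 v, v \in U & exists i, forall u, u \in U -> share v u -> u \in B i.
Proof.
have [s] := ubnP #|S|; elim: s S y => // s IHs S y leS yS attach [v0 v0U v0S].
(* Either some vertex of [U] confined to [S] avoids the bag at [y], and the branch can be shrunk, or
   all confined vertices lie in [B y]. *)
have [/existsP[v /and3P[vU /forallP vS yv]] | noV] :=
  boolP [exists v, [&& v \in U, [forall i, (v \in B i) ==> (i \in S)] & v \notin B y]].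
  have [x0 vx0] := cover_bag v.
  have x0S : x0 \in S := implyP (vS x0) vx0.
  pose Ty := [rel a b | [&& T a b, a != y & b != y]].
  have x0y : x0 != y by apply: contraNneq yv => <-.
  pose S' := [set j | connect Ty x0 j].
  have yS' : y \notin S'.
    rewrite inE; apply/negP => c.
    have x0Cy : x0 \in ~: [set y] by rewrite !inE.
    have yCy : y \notin ~: [set y] by rewrite !inE eqxx.
    have [a [b [/and3P[_ _ b_y] _]]] := connect_crossing c x0Cy yCy.
    by rewrite !inE (negPf b_y).
  have S'S : S' \subset S.
    apply/subsetP=> j; rewrite inE => c; apply/negPn/negP => jS.
    have [a [b [/and3P[Tab ay _] aS bS]]] := connect_crossing c x0S jS.
    by rewrite (attach a b) ?eqxx in ay.
  have out a b : a \in S' -> b \notin S' -> T a b -> b = y.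
    rewrite !inE => ca cb Tab; apply/eqP/negPn/negP => b_y; case/negP: cb.
    apply: (connect_trans ca); apply: connect1; rewrite /= Tab b_y andbT.
    by apply: contraNneq yS' => <-; rewrite inE.
  (* Two distinct neighbours of [y] in [S'] are joined by a simple path avoiding [y]; closing it
     through [y] gives a forbidden cycle. *)
  have uniq_port a b : a \in S' -> b \in S' -> T a y -> T b y -> a = b.
    move=> aS' bS' Tay Tby; apply/eqP/negPn/negP => ab.
    have c : connect Ty a b.
      have Ty_sym : connect_sym Ty.
        by apply: sym_connect_sym => p q /=; rewrite Tsym (andbC (p != y)).
      move: aS' bS'; rewrite !inE => ca; apply: connect_trans.
      by rewrite Ty_sym.
    case/connectP: c => p; case/shortenP => p' pp' up' _ bE.
    have allp' : all (predC1 y) p'.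
      elim: p' (a) pp' {up' bE} => //= x p' IHp' a' /andP[/and3P[_ _ ->]] /=.
      exact: IHp'.
    have /negP[] : ~~ cycle T [:: y, a & p'].
      have yp' : y \notin p' by apply/negP => /(allP allp'); rewrite /= eqxx.
      have ya : y != a by apply: contraNneq yS' => ->.
      apply: Tacyc; first by rewrite cons_uniq up' inE negb_or ya yp'.
      by case: (p') bE ab => //= ->; rewrite eqxx.
    rewrite /= Tsym Tay rcons_path -bE Tby andbT.
    by apply: sub_path pp' => p1 p2 /and3P[].
  have v_S' i : v \in B i -> i \in S'.
    move=> vi; rewrite inE; apply: connect_sub (conn_bag vx0 vi) => a b /and3P[Tab va vb].
    by apply: connect1; rewrite /= Tab /=; apply/andP; split; apply: contraNneq yv => <-.
  have ltS' : (#|S'| < s)%N.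
    rewrite (leq_trans _ (leS : (#|S| <= s)%N)) //; apply: proper_card.
    by apply/properP; split=> //; exists y.
  (* The neighbour [z] of [y] is the new attachment point. If there is none, no edge leaves [S'] and
     any of its nodes will do. *)
  have [/existsP[z /andP[zS' Tzy]]|noport] := boolP [exists z, (z \in S') && T z y].
    apply: (IHs S' z) => //; last by exists v.
    move=> a b aS' bS' Tab; apply: uniq_port => //.
    by rewrite -(out a b).
  apply: (IHs S' x0) => //; [by rewrite inE | | by exists v].
  move=> a b aS' bS' Tab; case/negP: noport; apply/existsP; exists a.
  by rewrite aS' -(out a b).
have yB v : v \in U -> (forall i, v \in B i -> i \in S) -> v \in B y.
  move=> vU vS; apply/negPn/negP => vy; case/negP: noV; apply/existsP; exists v.
  by rewrite vU vy andbT /=; apply/forallP => i; apply/implyP/vS.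
(* A neighbour [u] confined to [S] lies in [B y] by [yB]; otherwise its connected set of bags leaves
   [S], which is possible only through [y]. *)
exists v0 => //; exists y => u uU /existsP[j /andP[v0j uj]].
have [/forallP uS|] := boolP [forall i, (u \in B i) ==> (i \in S)].
  by apply: yB => // i; apply/implyP.
case/forallPn => j'; rewrite negb_imply => /andP[uj' j'S].
have [a [b [/and3P[Tab ua _] aS bS]]] := connect_crossing (conn_bag uj uj') (v0S _ v0j) j'S.
by rewrite -(attach a b).
Qed.

Lemma simplicial_vertex (U : {set 'I_n}) : U != set0 ->
  exists2 v, v \in U & exists i, forall u, u \in U -> share v u -> u \in B i.
Proof.
move=> /set0Pn[v vU]; have [i _] := cover_bag v.
apply: (@simplicial_in_branch U setT i) => //; first by move=> a b _; rewrite inE.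
by exists v => // j _; rewrite inE.
Qed.

(** Simplicial vertices are removed one by one: the remaining neighbours of the removed vertex lie
    in one bag, hence form a small clique. *)
Lemma tree_elim_order (U : {set 'I_n}) :
  exists r, [/\ uniq r, r =i U & elim_order share r].
Proof.
have [s] := ubnP #|U|; elim: s U => // s IHs U leU.
have [->|/simplicial_vertex[v vU [i vi]]] := eqVneq U set0.
  by exists [::]; split=> // x; rewrite inE.
have [r [ur rU or]] : exists r, [/\ uniq r, r =i U :\ v & elim_order share r].
  by apply: IHs; rewrite (cardsD1 v) vU in leU.
have sub : [set u in r | share v u] \subset B i.
  by apply/subsetP=> u; rewrite inE rU !inE => /andP[/andP[_ uU]]; apply: vi.
exists (v :: r); split=> /=.
- by rewrite ur rU !inE eqxx.
- by move=> x; rewrite inE rU !inE; case: eqVneq => // ->.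
split=> //; first exact: leq_trans (subset_leq_card sub) (width i).
move=> x y /(subsetP sub) xi /(subsetP sub) yi.
by apply/existsP; exists i; rewrite xi.
Qed.

End Tree.

(* [D] is the set of vertices that the single accumulated factor depends on. *)
Fixpoint linear_elim_order (E : rel 'I_n) (D : {set 'I_n}) (r : seq 'I_n) : Prop :=
  if r is v :: r' then
    let D' := [set u in r' | (u \in D) || E v u] in
    (#|D'| <= w.+1)%N /\ linear_elim_order E D' r'
  else True.

Section Path.
Hypothesis conn_bag : forall v i j, v \in B i -> v \in B j ->
  connect [rel x y | [&& path_rel x y, v \in B x & v \in B y]] i j.

(** A walk through the bags of [v] changes the index by one at a time, so to get past the indices
    below [l] it must step onto [l]. *)
Lemma bag_interval v (i l j : 'I_t) :
  v \in B i -> v \in B j -> (i <= l <= j)%N -> v \in B l.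
Proof.
move=> vi vj /andP[il lj]; apply/negPn/negP => vl.
have ltil : (i < l)%N.
  by rewrite ltn_neqAle il andbT; apply: contraNneq vl => /val_inj <-.
pose S := [set x : 'I_t | (x < l)%N].
have iS : i \in S by rewrite inE.
have jS : j \notin S by rewrite inE -leqNgt.
have [a [b []]] := connect_crossing (conn_bag vi vj) iS jS; rewrite !inE -leqNgt => /and3P[pab _ vb] al lb.
have /val_inj bl : b = l :> nat by move: pab; rewrite /path_rel; lia.
by rewrite -bl vb in vl.
Qed.

Definition last_bag v : nat := \max_(i | v \in B i) i.

Lemma last_bagP v : exists2 i, v \in B i & last_bag v = i.
Proof.
have [i vi] := cover_bag v.
have [|j vj jE] := @eq_bigmax_cond _ [pred i | v \in B i] (fun i : 'I_t => i : nat).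
  by apply/card_gt0P; exists i.
by exists j.
Qed.

Lemma last_bag_ge v i : v \in B i -> (i <= last_bag v)%N.
Proof. by move=> vi; apply: (@leq_bigmax_cond _ _ (fun i : 'I_t => i : nat)). Qed.

(** The invariant is that each vertex of [D] already occurs in a bag no later than the last bag of
    any remaining vertex. A vertex of the new scope thus has a bag at or before the last bag [l] of
    [v], and its own last bag is at or after [l], so it lies in [B l]. *)
Lemma sorted_linear_elim_order (D : {set 'I_n}) r :
  sorted (fun u v => (last_bag u <= last_bag v)%N) r ->
  (forall u, u \in D -> exists2 j, u \in B j &
     forall v, v \in r -> (j <= last_bag v)%N) ->
  linear_elim_order share D r.
Proof.
elim: r D => //= v r IHr D sr DB.
have le_tr : transitive (fun u v => (last_bag u <= last_bag v)%N).
  by move=> a b c; apply: leq_trans.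
have vr u : u \in r -> (last_bag v <= last_bag u)%N.
  by move/(allP (order_path_min le_tr sr)).
have [l vl lE] := last_bagP v.
set D' := [set u in r | _].
have sub : D' \subset B l.
  apply/subsetP=> u; rewrite inE => /andP[ur Du].
  have [k uk kE] := last_bagP u.
  have [j uj jl] : exists2 j, u \in B j & (j <= l)%N.
    case/orP: Du => [/DB[j uj jle]|/existsP[j /andP[vj uj]]]; exists j => //.
      by rewrite -lE jle ?mem_head.
    by rewrite -lE last_bag_ge.
  by apply: bag_interval uj uk _; rewrite jl -lE -kE vr.
split; first exact: leq_trans (subset_leq_card sub) (width l).
apply: IHr; first exact: path_sorted sr.
by move=> u /(subsetP sub) ul; exists l => // x xr; rewrite -lE vr.
Qed.

Lemma path_elim_order :
  exists r, [/\ uniq r, r =i predT & linear_elim_order share set0 r].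
Proof.
exists (sort (fun u v => (last_bag u <= last_bag v)%N) (enum 'I_n)); split.
- by rewrite sort_uniq enum_uniq.
- by move=> x; rewrite mem_sort mem_enum.
apply: sorted_linear_elim_order; last by move=> u; rewrite inE.
by apply: sort_sorted => u v; apply: leq_total.
Qed.

End Path.
End Decomposition.

(** * Straight-line programs and their translation into circuits *)

Section StraightLine.
Variables (R : comNzRingType) (N : nat) (sk : bool).
Implicit Types (p q : {mpoly R[N]}) (s L : seq {mpoly R[N]}) (C : seq (gate R N)).

(** A variable or a constant; comparison with the constant coefficient keeps the test boolean. *)
Definition leaf p : bool :=
  [exists i, p == 'X_i] || (p == (mcoeff 0%MM p)%:MP).

Lemma leafX i : leaf 'X_i.
Proof. by apply/orP; left; apply/existsP; exists i. Qed.

Lemma leafC c : leaf c%:MP.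
Proof. by apply/orP; right; rewrite mcoeffC eqxx mulr1. Qed.

Lemma leaf0 : leaf 0.
Proof. by rewrite -(mpolyC0 N R) leafC. Qed.

Lemma leaf1 : leaf 1.
Proof. by rewrite -(mpolyC1 N R) leafC. Qed.

(** Operands are referred to by value instead of by gate number. The flag [sk] imposes skewness,
    with the leaf as left factor. *)
Definition slp_step s p : bool :=
  [|| leaf p,
      has (fun q => has (fun q' => p == q + q') s) s |
      has (fun q => (sk ==> leaf q) && has (fun q' => p == q * q') s) s].

(* Straight-line programs are listed with the most recent polynomial first. *)
Fixpoint slp s : bool :=
  if s is p :: s' then slp_step s' p && slp s' else true.

Lemma slp_leaves s : all leaf s -> slp s.
Proof. by elim: s => //= p s IHs /andP[lp /IHs->]; rewrite /slp_step lp. Qed.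

Lemma slp_add s p q : slp s -> p \in s -> q \in s -> slp ((p + q) :: s).
Proof.
move=> ss ps qs; rewrite /= ss andbT /slp_step; apply/or3P; constructor 2.
by apply/hasP; exists p => //; apply/hasP; exists q.
Qed.

Lemma slp_mul s p q :
  slp s -> p \in s -> q \in s -> (sk -> leaf p) -> slp ((p * q) :: s).
Proof.
move=> ss ps qs lp; rewrite /= ss andbT /slp_step; apply/or3P; constructor 3.
by apply/hasP; exists p => //; apply/andP; split; [apply/implyP | apply/hasP; exists q].
Qed.

Lemma wf_circuit_rcons C g : wf_circuit (rcons C g) =
  (match g with
   | GAdd a b | GMul a b => (a < size C) && (b < size C) | _ => true end)%N
  && wf_circuit C.
Proof.
rewrite /wf_circuit size_rcons -addn1 iotaD /= cats1 add0n.
by rewrite zip_rcons ?size_iota // all_rcons.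
Qed.

Lemma circ_vals_rcons C g :
  circ_vals (rcons C g) = rcons (circ_vals C) (gate_val (circ_vals C) g).
Proof. by rewrite /circ_vals -cats1 foldl_cat. Qed.

Lemma has_leafP C a :
  has (fun ig : nat * gate R N => (ig.1 == a) && is_leaf ig.2)%N
      (zip (iota 0 (size C)) C) =
  (a < size C)%N && is_leaf (nth (GConst N 0) C a).
Proof.
elim/last_ind: C => [|C g IHC]; first by rewrite ltn0.
rewrite size_rcons -addn1 iotaD /= cats1 add0n zip_rcons ?size_iota //.
rewrite has_rcons IHC /= nth_rcons addn1 ltnS [(a <= _)%N]leq_eqVlt [size C == a]eq_sym.
by case: ltngtP => //= _; rewrite ?andbF ?orbF.
Qed.

Lemma skew_circuit_rcons C g :
  skew_circuit C ->
  (if g is GMul a _ then (a < size C)%N && is_leaf (nth (GConst N 0) C a)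
   else true) ->
  skew_circuit (rcons C g).
Proof.
have leaf_rcons a : (a < size C)%N && is_leaf (nth (GConst N 0) C a) ->
    (a < size (rcons C g))%N && is_leaf (nth (GConst N 0) (rcons C g) a).
  by case/andP=> aC la; rewrite size_rcons nth_rcons aC ltnS ltnW.
move=> skC skg; rewrite /skew_circuit all_rcons; apply/andP; split.
  by case: g skg leaf_rcons => // a b la lr; rewrite has_leafP lr.
apply: sub_all skC => -[] // a b; rewrite !has_leafP.
by case/orP=> /leaf_rcons -> //; rewrite orbT.
Qed.

(** Gate numbers are recovered as positions in [rev s]. The last clause carries skewness through the
    induction: a leaf operand must sit at an input gate. *)
Lemma slp_gates s : slp s -> exists C,
  [/\ size C = size s, wf_circuit C, sk -> skew_circuit C, circ_vals C = rev s &
      forall i, (i < size s)%N -> leaf (nth 0 (rev s) i) ->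
        is_leaf (nth (GConst N 0) C i)].
Proof.
elim: s => [|p s IHs] /=; first by exists [::].
case/andP=> stp /IHs[C [szC wfC skC valC leavesC]].
suff [g [gv wg skg lg]] : exists g,
    [/\ gate_val (circ_vals C) g = p,
        (match g with
         | GAdd a b | GMul a b => (a < size C) && (b < size C)
         | _ => true end : bool)%N,
        (sk -> if g is GMul a _ then (a < size C)%N && is_leaf (nth (GConst N 0) C a)
               else true) &
        leaf p -> is_leaf g].
  exists (rcons C g); rewrite size_rcons szC wf_circuit_rcons wg circ_vals_rcons gv.
  rewrite valC rev_cons; split=> // [skT|i].
    by apply: skew_circuit_rcons; [apply: skC | apply: skg].
  rewrite ltnS leq_eqVlt !nth_rcons szC size_rev.
  by case: ltngtP => //= il _; apply: leavesC.
have idx q : q \in s ->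
    (index q (rev s) < size C)%N /\ nth 0 (circ_vals C) (index q (rev s)) = q.
  by move=> qs; rewrite valC nth_index ?mem_rev // szC -(size_rev s) index_mem mem_rev.
(* Leaves are tested first, so they become input gates even when they are also sums or products of
   earlier entries. *)
have [/orP[/existsP[i /eqP ->]|/eqP pE]|nlp] := boolP (leaf p).
- by exists (GVar R i).
- by exists (GConst N (mcoeff 0%MM p)); rewrite /= -pE.
case/or3P: stp; first by rewrite (negPf nlp).
  case/hasP=> q /idx[qi qE] /hasP[q' /idx[qi' qE'] /eqP pE].
  by exists (GAdd R N (index q (rev s)) (index q' (rev s))); rewrite /= qE qE' qi.
case/hasP=> q /idx[qi qE] /andP[/implyP lq /hasP[q' /idx[qi' qE'] /eqP pE]].
exists (GMul R N (index q (rev s)) (index q' (rev s))); rewrite /= qE qE' qi.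
split=> // skT; apply: leavesC; first by rewrite -szC.
by move: qE; rewrite valC => ->; apply: lq.
Qed.

(** A circuit outputs its last gate, so the entries more recent than [f] are dropped first. *)
Lemma slp_circuit s f : slp s -> f \in s -> exists C,
  [/\ (size C <= size s)%N, sk -> skew_circuit C & computes C f].
Proof.
elim: s => //= p s IHs /andP[stp ss]; rewrite inE => /predU1P[->|fs]; last first.
  by have [C [szC skC fC]] := IHs ss fs; exists C; split=> //; apply: leqW.
have [|C [szC wfC skC valC _]] := @slp_gates (p :: s); first by rewrite /= stp.
exists C; split=> //; first by rewrite szC.
by split; rewrite ?szC // valC rev_cons last_rcons.
Qed.

Lemma slp_sum s L : slp s -> {subset L <= s} -> exists s',
  [/\ slp s', {subset s <= s'}, (size s' <= size s + (size L).+1)%N &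
      \sum_(p <- L) p \in s'].
Proof.
move=> ss; elim: L => [|p L IHL] Ls.
  exists (0 :: s); rewrite big_nil mem_head /= ss /slp_step leaf0 addn1; split=> //.
  by move=> q qs; rewrite inE qs orbT.
have [|s' [ss' sub sz sumL]] := IHL.
  by move=> q qL; apply: Ls; rewrite inE qL orbT.
exists ((p + \sum_(p <- L) p) :: s'); rewrite big_cons mem_head; split=> //.
- by apply: slp_add => //; apply/sub/Ls/mem_head.
- by move=> q /sub qs; rewrite inE qs orbT.
- by move: sz => /=; lia.
Qed.

(** The elements of [L] are multiplied onto [q] one at a time from the left, so leaves in [L]
    suffice for skewness while [q] is arbitrary. *)
Lemma slp_prod s q L : slp s -> q \in s -> {subset L <= s} ->
  (sk -> all leaf L) -> exists s',
  [/\ slp s', {subset s <= s'}, (size s' <= size s + size L)%N &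
      (\prod_(p <- L) p) * q \in s'].
Proof.
move=> ss qs; elim: L => [|p L IHL] Ls lL.
  by exists s; rewrite big_nil mul1r /= addn0; split.
have [||s' [ss' sub sz sumL]] := IHL.
- by move=> r rL; apply: Ls; rewrite inE rL orbT.
- by move/lL; case/andP.
exists ((p * (\prod_(p <- L) p * q)) :: s'); rewrite big_cons -mulrA mem_head.
split=> //.
- apply: slp_mul => //; first exact/sub/Ls/mem_head.
  by move/lL; case/andP.
- by move=> r /sub rs; rewrite inE rs orbT.
- by move: sz => /=; lia.
Qed.

(** The hypothesis ranges over all extensions of [s0] because the computations for the elements of
    [X] are stacked on one another. *)
Lemma slp_iter (I : eqType) (X : seq I) (f : I -> {mpoly R[N]}) c s0 : slp s0 ->
  (forall x s, x \in X -> slp s -> {subset s0 <= s} -> exists s',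
     [/\ slp s', {subset s <= s'}, (size s' <= size s + c)%N & f x \in s']) ->
  exists s, [/\ slp s, {subset s0 <= s}, (size s <= size s0 + size X * c)%N &
                {in X, forall x, f x \in s}].
Proof.
move=> ss0; elim: X => [|x X IHX] fX.
  by exists s0; rewrite /= addn0; split=> // x.
have [y s yX|s [ss sub sz fs]] := IHX; first by apply: fX; rewrite inE yX orbT.
have [s' [ss' sub' sz' fx]] := fX x s (mem_head _ _) ss sub.
exists s'; split=> //; first by move=> p /sub/sub'.
  by move: sz sz' => /=; lia.
by move=> y; rewrite inE => /predU1P[->//|/fs/sub'].
Qed.

End StraightLine.

(** * Summing out vertices and its cost *)

Section Elimination.
Variables (n : nat) (K : finType) (a0 : K) (R : comNzRingType) (N : nat).
Local Notation A := {mpoly R[N]}.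
Local Notation asg := {ffun 'I_n -> K}.
Local Notation factor := ({set 'I_n} * {ffun asg -> A})%type.
Implicit Types (phi psi : asg) (v : 'I_n) (g : asg -> A) (S : {set 'I_n}).
Implicit Types (r : seq 'I_n) (Fs : seq factor) (F : factor) (s : seq A).

Definition upd phi v a : asg := [ffun x => if x == v then a else phi x].

Definition sumout v g phi : A := \sum_a g (upd phi v a).

(** The head of [r] is summed out first, so it is the innermost sum. *)
Fixpoint sumouts r g : asg -> A :=
  if r is v :: r' then sumouts r' (sumout v g) else g.

Definition depends_on S g : Prop :=
  forall phi psi, {in S, phi =1 psi} -> g phi = g psi.

Definition prodf Fs phi : A := \prod_(F <- Fs) F.2 phi.

Lemma eq_sumout v g g' : g =1 g' -> sumout v g =1 sumout v g'.
Proof. by move=> gg' phi; apply: eq_bigr => a _. Qed.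

Lemma eq_sumouts r g g' : g =1 g' -> sumouts r g =1 sumouts r g'.
Proof. by elim: r g g' => //= v r IHr g g' gg'; apply/IHr/eq_sumout. Qed.

Lemma sumoutsE r g phi : uniq r ->
  sumouts r g phi = \sum_(psi : asg | [forall x, (x \in r) || (psi x == phi x)]) g psi.
Proof.
elim: r g => [|v r IHr] g /= => [_|/andP[vr ur]].
  rewrite (big_pred1 phi) // => psi; apply/forallP/eqP => [psiE|-> x]; last by rewrite eqxx.
  by apply/ffunP => x; apply/eqP; apply: psiE.
rewrite IHr // /sumout pair_big /=.
(* An assignment is split into its value at [v] and the assignment reset to [phi v] there. *)
rewrite [RHS](reindex_onto (fun pa : asg * K => upd pa.1 v pa.2)
                           (fun psi => (upd psi v (phi v), psi v))) /=; last first.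
  by move=> psi _; apply/ffunP => x; rewrite !ffunE; case: eqP => // ->.
apply: eq_bigl => -[psi a] /=; rewrite andbT xpair_eqE.
have -> : upd psi v a v = a by rewrite ffunE eqxx.
rewrite eqxx andbT; apply/forallP/andP => [psiE|[/forallP psiE /eqP psiv] x].
  split; first by apply/forallP => x; rewrite !ffunE inE; case: eqP => //= _; apply: psiE.
  apply/eqP/ffunP => x; rewrite !ffunE; case: eqP => // ->.
  by have := psiE v; rewrite (negPf vr) /= => /eqP.
have [->|xv] := eqVneq x v; first by rewrite -psiv !ffunE eqxx eqxx orbT.
by have := psiE x; rewrite inE ffunE (negPf xv).
Qed.

Lemma sumouts_full r g phi : uniq r -> r =i predT ->
  sumouts r g phi = \sum_(psi : asg) g psi.
Proof.
move=> ur rT; rewrite sumoutsE //; apply: eq_bigl => psi.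
by apply/forallP => x; rewrite rT.
Qed.

Lemma depends_onS S S' g : S \subset S' -> depends_on S g -> depends_on S' g.
Proof. by move=> /subsetP sub gS phi psi e; apply: gS => x /sub /e. Qed.

Lemma depends_sumout v S g : depends_on (v |: S) g -> depends_on S (sumout v g).
Proof.
move=> gS phi psi e; apply: eq_bigr => a _; apply: gS => x; rewrite !inE !ffunE.
by case: eqP => //= _ /e.
Qed.

Lemma depends_prodf S Fs :
  (forall F, F \in Fs -> depends_on F.1 F.2 /\ F.1 \subset S) ->
  depends_on S (prodf Fs).
Proof.
move=> FsS phi psi e; rewrite /prodf !big_seq; apply: eq_bigr => F /FsS[Fd FS].
by apply: Fd => x /(subsetP FS) /e.
Qed.

Lemma depends_onM S g g' : depends_on S g -> depends_on S g' ->
  depends_on S (fun phi => g phi * g' phi).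
Proof. by move=> gS gS' phi psi e; rewrite (gS _ _ e) (gS' _ _ e). Qed.

(** Distributivity: factors whose scope misses [v] are constant in the sum and can be pulled out. *)
Lemma sumout_prodf v Fs g phi : (forall F, F \in Fs -> depends_on F.1 F.2) ->
  sumout v (fun psi => prodf Fs psi * g psi) phi =
  sumout v (fun psi => prodf [seq F : factor <- Fs | v \in F.1] psi * g psi) phi *
  prodf [seq F : factor <- Fs | v \notin F.1] phi.
Proof.
move=> Fsd; rewrite /sumout mulr_suml; apply: eq_bigr => a _.
rewrite /prodf (bigID (fun F : factor => v \in F.1)) /= !big_filter.
set x := \prod_(F <- _ | _) _; set y := \prod_(F <- _ | _) _; set z := \prod_(F <- _ | _) _.
suff -> : y = z by rewrite mulrAC.
rewrite /y /z !(big_seq_cond (fun F : factor => v \notin F.1)); apply: eq_bigr => F /andP[/Fsd Fd vF].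
by apply: Fd => u uF; rewrite ffunE; case: eqP => // uv; rewrite -uv uF in vF.
Qed.

Section Cost.
Variable sk : bool.

(* It suffices to compute [g] on the assignments that equal [a0] off [S]. *)
Lemma slp_table S g c s0 : slp sk s0 -> depends_on S g ->
  (forall phi s, slp sk s -> {subset s0 <= s} -> exists s',
     [/\ slp sk s', {subset s <= s'}, (size s' <= size s + c)%N & g phi \in s']) ->
  exists s, [/\ slp sk s, {subset s0 <= s}, (size s <= size s0 + #|K| ^ #|S| * c)%N &
                forall phi, g phi \in s].
Proof.
move=> ss0 gS gphi.
have [phi s _|s [ss sub sz gs]] := @slp_iter R N sk _ (enum (pffun_on a0 (mem S) predT)) g c s0 ss0.
  exact: gphi.
exists s; split=> //; first by move: sz; rewrite -cardE card_pffun_on.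
move=> phi; pose psi : asg := [ffun x => if x \in S then phi x else a0].
have -> : g phi = g psi by apply: gS => x xS; rewrite ffunE xS.
apply: gs; rewrite mem_enum; apply/pffun_onP; split=> //.
by apply/subsetP => x; rewrite inE /= ffunE; case: ifP => //; rewrite eqxx.
Qed.

(** Each of the [#|K| ^ #|S|] table entries takes [#|K|] products onto values of [g] and one sum. In
    the skew case only the factors [Fs] must be leaves; the table [g] is free. *)
Lemma slp_sumout v S Fs g s0 : slp sk s0 ->
  (forall F phi, F \in Fs -> F.2 phi \in s0 /\ (sk -> leaf (F.2 phi))) ->
  (forall phi, g phi \in s0) ->
  depends_on S (sumout v (fun psi => prodf Fs psi * g psi)) ->
  exists s, [/\ slp sk s, {subset s0 <= s},
    (size s <= size s0 + #|K| ^ #|S| * (#|K| * size Fs + #|K|.+1))%N &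
    forall phi, sumout v (fun psi => prodf Fs psi * g psi) phi \in s].
Proof.
move=> ss0 Fs0 gs0 dep; apply: slp_table => // phi s ss sub.
pose f a := prodf Fs (upd phi v a) * g (upd phi v a).
have [a s1 _ ss1 sub1|s1 [ss1 sub1 sz1 fs1]] := @slp_iter R N sk _ (enum K) f (size Fs) s ss.
  have := @slp_prod R N sk s1 (g (upd phi v a)) [seq F.2 (upd phi v a) | F <- Fs] ss1.
  rewrite size_map big_map; apply; first exact/sub1/sub.
    by move=> _ /mapP[F /(Fs0 F (upd phi v a))[Fs1 _] ->]; apply/sub1/sub.
  by move=> skT; apply/allP => _ /mapP[F /(Fs0 F (upd phi v a))[_ lF] ->]; apply: lF.
have [|s2 [ss2 sub2 sz2 fs2]] := @slp_sum R N sk s1 [seq f a | a <- enum K] ss1.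
  by move=> _ /mapP[a /fs1 fa ->].
exists s2; split=> //; first by move=> p /sub1/sub2.
  by move: sz1 sz2; rewrite (size_map f) -cardT; lia.
by move: fs2; rewrite big_map big_enum.
Qed.

End Cost.

Section Orders.
Variables (w : nat) (E : rel 'I_n).

Let step_cost M := (#|K| ^ w.+1 * (#|K| * M + #|K|.+1))%N.

Lemma step_cost_le (S : {set 'I_n}) m M : (#|S| <= w.+1)%N -> (m <= M)%N ->
  (#|K| ^ #|S| * (#|K| * m + #|K|.+1) <= step_cost M)%N.
Proof.
move=> Sw mM; apply: leq_mul; last by rewrite leq_add2r leq_mul2l mM orbT.
by apply: leq_pexp2l => //; apply/card_gt0P; exists a0.
Qed.

(** The invariant is that every scope is a clique among the remaining vertices and all factor values
    are already computed. Each step removes a vertex and adds one factor, so [size Fs + size r] does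
    not grow; the final [M] pays for the last product. *)
Lemma slp_elim_order M r Fs s0 phi : uniq r -> elim_order w E r ->
  slp false s0 -> 1 \in s0 ->
  (forall F, F \in Fs -> [/\ depends_on F.1 F.2, F.1 \subset [set x in r],
     {in F.1 &, forall x y, E x y} & forall psi, F.2 psi \in s0]) ->
  (size Fs + size r <= M)%N ->
  exists s, [/\ slp false s, (size s <= size s0 + size r * step_cost M + M)%N &
                sumouts r (prodf Fs) phi \in s].
Proof.
elim: r Fs s0 => [|v r IHr] Fs s0 /=.
  move=> _ _ ss0 s01 Fs0 FsM.
  have [||s [ss _ sz fs]] := @slp_prod R N false s0 1 [seq F.2 phi | F <- Fs] ss0 s01.
  - by move=> _ /mapP[F /Fs0[_ _ _ Fs1] ->].
  - by [].
  exists s; move: fs sz; rewrite mulr1 big_map size_map; split=> //; lia.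
case/andP=> vr ur [Sw Scl Er] ss0 s01 Fs0 FsM.
set S := [set u in r | E v u] in Sw Scl.
pose Fin := [seq F : factor <- Fs | v \in F.1]; pose Fout := [seq F : factor <- Fs | v \notin F.1].
(* The constant 1 fills the place of the table [g] in [slp_sumout]. *)
pose h := sumout v (fun psi => prodf Fin psi * 1).
have szF : (size Fin <= size Fs)%N by rewrite size_filter count_size.
have szF' : (size Fout <= size Fs)%N by rewrite size_filter count_size.
(* A scope containing [v] is a clique, so its other vertices are later neighbours of [v]. *)
have hS : depends_on S h.
  apply/depends_sumout/depends_onM => //; apply: depends_prodf => F.
  rewrite mem_filter => /andP[vF /Fs0[Fd Fr Fcl _]]; split=> //.
  apply/subsetP => u uF; have := subsetP Fr u uF; rewrite !inE.
  by case: eqP => //= _ ->; apply: Fcl.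
have [F psi||s1 [ss1 sub1 sz1 hs1]] := @slp_sumout false v S Fin (fun=> 1) s0 ss0 _ _ hS.
- by rewrite mem_filter => /andP[_ /Fs0[_ _ _ Fs1]].
- by [].
have [||s [ss sz fs]] := IHr ((S, [ffun psi => h psi]) :: Fout) s1 ur Er ss1 (sub1 _ s01).
- move=> F; rewrite inE => /predU1P[->|] /=.
    split=> // [phi' psi e||psi].
    + by rewrite !ffunE; apply: hS.
    + by apply/subsetP => u; rewrite !inE => /andP[].
    + by rewrite ffunE; apply: hs1.
  rewrite mem_filter => /andP[vF /Fs0[Fd Fr Fcl Fs1]]; split=> // [|psi]; last exact/sub1.
  apply/subsetP => u uF; have := subsetP Fr u uF; rewrite !inE.
  by case/predU1P => // uv; rewrite -uv uF in vF.
- by move: FsM => /=; lia.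
exists s; split=> //.
  have := @step_cost_le S (size Fin) M Sw; rewrite mulSn => c_le.
  have : (size Fin <= M)%N by lia.
  by move/c_le; lia.
suff -> : sumouts r (sumout v (prodf Fs)) phi =
          sumouts r (prodf ((S, [ffun psi => h psi]) :: Fout)) phi by [].
apply: eq_sumouts => psi; rewrite {2}/prodf big_cons /= ffunE -/(prodf Fout psi) -sumout_prodf.
  by apply: eq_sumout => psi'; rewrite mulr1.
by move=> F /Fs0[].
Qed.

(** The summed-out function replaces the accumulator [q] instead of joining [Fs]. Hence [Fs] keeps
    only leaf-valued factors, and every product multiplies a leaf onto the accumulator. *)
Lemma slp_linear_elim_order M r (D : {set 'I_n}) (q : asg -> A) Fs s0 phi :
  uniq r -> linear_elim_order w E D r ->
  slp true s0 -> (forall psi, q psi \in s0) ->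
  depends_on D q -> D \subset [set x in r] ->
  (forall F, F \in Fs -> [/\ depends_on F.1 F.2, F.1 \subset [set x in r],
     {in F.1 &, forall x y, E x y} & forall psi, F.2 psi \in s0 /\ leaf (F.2 psi)]) ->
  (size Fs <= M)%N ->
  exists s, [/\ slp true s, (size s <= size s0 + size r * step_cost M + M)%N &
                sumouts r (fun psi => prodf Fs psi * q psi) phi \in s].
Proof.
elim: r D q Fs s0 => [|v r IHr] D q Fs s0 /=.
  move=> _ _ ss0 qs0 _ _ Fs0 FsM.
  have [||s [ss _ sz fs]] := @slp_prod R N true s0 (q phi) [seq F.2 phi | F <- Fs] ss0 (qs0 phi).
  - by move=> _ /mapP[F /Fs0[_ _ _ Fs1] ->]; have [] := Fs1 phi.
  - by move=> _; apply/allP => _ /mapP[F /Fs0[_ _ _ Fs1] ->]; have [] := Fs1 phi.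
  exists s; move: fs sz; rewrite big_map size_map; split=> //; lia.
case/andP=> vr ur [Sw Er] ss0 qs0 qD Dr Fs0 FsM.
set S := [set u in r | _] in Sw Er.
pose Fin := [seq F : factor <- Fs | v \in F.1]; pose Fout := [seq F : factor <- Fs | v \notin F.1].
pose h := sumout v (fun psi => prodf Fin psi * q psi).
have szF : (size Fin <= size Fs)%N by rewrite size_filter count_size.
have szF' : (size Fout <= size Fs)%N by rewrite size_filter count_size.
have hS : depends_on S h.
  apply/depends_sumout/depends_onM.
    apply: depends_prodf => F.
    rewrite mem_filter => /andP[vF /Fs0[Fd Fr Fcl _]]; split=> //.
    apply/subsetP => u uF; have := subsetP Fr u uF; rewrite !inE.
    by case: eqP => //= _ ->; rewrite Fcl ?orbT.
  apply: depends_onS qD; apply/subsetP => u uD; have := subsetP Dr u uD; rewrite !inE.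
  by case: eqP => //= _ ->; rewrite uD.
have [F psi|s1 [ss1 sub1 sz1 hs1]] := @slp_sumout true v S Fin q s0 ss0 _ qs0 hS.
  by rewrite mem_filter => /andP[_ /Fs0[_ _ _ Fs1]]; have [] := Fs1 psi.
have [|||s [ss sz fs]] := IHr S h Fout s1 ur Er ss1 hs1 hS.
- by apply/subsetP => u; rewrite !inE => /andP[].
- move=> F; rewrite mem_filter => /andP[vF /Fs0[Fd Fr Fcl Fs1]].
  split=> // [|psi]; last by have [/sub1] := Fs1 psi.
  apply/subsetP => u uF; have := subsetP Fr u uF; rewrite !inE.
  by case/predU1P => // uv; rewrite -uv uF in vF.
- exact: leq_trans szF' FsM.
exists s; split=> //.
  have := @step_cost_le S (size Fin) M Sw (leq_trans szF FsM).
  by rewrite mulSn; lia.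
suff -> : sumouts r (sumout v (fun psi => prodf Fs psi * q psi)) phi =
          sumouts r (fun psi => prodf Fout psi * h psi) phi by [].
apply: eq_sumouts => psi; rewrite mulrC -sumout_prodf //.
by move=> F /Fs0[].
Qed.

End Orders.
End Elimination.

(** * The homomorphism polynomial as a sum of products of local factors *)

Section HomPoly.
Variables (R : comNzRingType) (G H : sgraph).
Local Notation n := (nv G).
Local Notation k := (nv H).
Local Notation A := {mpoly R[hom_nvars G H]}.
Local Notation asg := {ffun 'I_n -> 'I_k}.

Definition hom_edges : seq ('I_n * 'I_n) :=
  [seq p : 'I_n * 'I_n <- enum {: 'I_n * 'I_n} | (p.1 < p.2)%N && adj p.1 p.2].

Definition hom_factors : seq ({set 'I_n} * {ffun asg -> A}) :=
  [seq ([set u], [ffun phi : asg => 'X_(zvar u (phi u))]) | u <- enum 'I_n] ++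
  [seq ([set p.1; p.2],
        [ffun phi : asg => if adj (phi p.1) (phi p.2)
                           then 'X_(yvar n (phi p.1) (phi p.2)) else 0])
  | p <- hom_edges].

Lemma hom_factorsP (P : {set 'I_n} * {ffun asg -> A} -> Prop) :
  (forall u, P ([set u], [ffun phi : asg => 'X_(zvar u (phi u))])) ->
  (forall u v, adj u v -> P ([set u; v],
     [ffun phi : asg => if adj (phi u) (phi v)
                        then 'X_(yvar n (phi u) (phi v)) else 0])) ->
  forall F, F \in hom_factors -> P F.
Proof.
move=> PZ PY F; rewrite mem_cat => /orP[/mapP[u _ ->]|/mapP[p]]; first exact: PZ.
by rewrite mem_filter => /andP[/andP[_ uv] _] ->; apply: PY.
Qed.

Lemma size_hom_factors : (size hom_factors <= n + n * n)%N.
Proof.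
rewrite size_cat; apply: leq_add; rewrite size_map ?size_enum_ord // size_filter.
by rewrite (leq_trans (count_size _ _)) // -cardE card_prod card_ord.
Qed.

(** An assignment that is not a homomorphism breaks some edge, whose factor is then 0. *)
Lemma hom_polyE : hom_poly R G H = \sum_(phi : asg) prodf hom_factors phi.
Proof.
rewrite /hom_poly big_mkcond; apply: eq_bigr => phi _.
rewrite /prodf big_cat /=.
have [/forallP hom_phi|nhom] := boolP (is_hom phi).
  congr (_ * _); first by rewrite big_map big_enum; apply: eq_bigr => u _; rewrite ffunE.
  rewrite big_map big_filter big_enum_cond; apply: eq_bigr => p /andP[_ pE]; rewrite ffunE.
  by have /forallP/(_ p.2)/implyP/(_ pE) -> := hom_phi p.1.
(* The broken edge is oriented as in [hom_edges], using symmetry in both graphs; irreflexivity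
   excludes [u = v]. *)
have [u [v [uv Euv Nuv]]] : exists u v : 'I_n, [/\ (u < v)%N, adj u v & ~~ adj (phi u) (phi v)].
  case/forallPn: nhom => u /forallPn[v]; rewrite negb_imply => /andP[Euv Nuv].
  have [uv|vu|/val_inj uv] := ltngtP u v; first by exists u, v.
    by exists v, u; rewrite adj_sym (adj_sym (phi v)).
  by rewrite uv adj_irr in Euv.
rewrite [X in _ * X]big_map big_filter big_enum_cond /= (bigD1 (u, v)) /= ?uv //.
by rewrite ffunE (negPf Nuv) mul0r mulr0.
Qed.

(** Settles the empty target graph, which offers no default value [a0] for the elimination. *)
Lemma hom_poly_const : k = 0%N -> exists c, hom_poly R G H = c%:MP.
Proof.
move=> k0; have no (x : 'I_k) : False by case: x => x; rewrite k0.
apply: (big_ind (fun x : A => exists c, x = c%:MP)).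
- by exists 0; rewrite mpolyC0.
- by move=> _ _ [c ->] [d ->]; exists (c + d); rewrite mpolyCD.
move=> phi _; exists 1; rewrite mpolyC1 !big1 ?mulr1 // => u _.
  by have := no (phi u.1).
by have := no (phi u).
Qed.

Lemma msize_hom_poly : (msize (hom_poly R G H) <= 1 + 3 * (n + n * n))%N.
Proof.
have sz1 : (msize (1 : A) <= 1)%N by rewrite -mpolyC1 msizeC; case: eqP.
have sz0 : msize (0 : A) = 0%N by rewrite -(mpolyC0 _ R) msizeC eqxx.
rewrite hom_polyE; apply: (big_ind (fun p : A => msize p <= _)%N).
- by rewrite sz0.
- by move=> p q ple qle; rewrite (leq_trans (msizeD_le _ _)) // geq_max ple.
move=> phi _; have := size_hom_factors; have : forall F, F \in hom_factors -> (msize (F.2 phi) <= 2)%N.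
  apply: hom_factorsP => [u|u v _] /=; rewrite ffunE; first by rewrite msizeX mdeg1.
  by case: ifP => _; rewrite ?sz0 // msizeX mdeg1.
rewrite /prodf => szF szFs.
(* Each factor has [msize] at most 2, and the product bound adds 1 per multiplication, hence 3. *)
apply: (@leq_trans (1 + 3 * size hom_factors)); last by rewrite leq_add2l leq_mul2l.
elim: hom_factors szF {szFs} => [|F Fs IHF] szF; first by rewrite big_nil.
rewrite big_cons (leq_trans (msizeM_le _ _)) //.
rewrite [size _]/= mulnS addnCA -addSn.
apply: leq_add; first exact: szF (mem_head _ _).
by apply: IHF => F' F'in; apply: szF; rewrite inE F'in orbT.
Qed.

(** All values that local factors can take, together with 1 as the empty product and initial
    accumulator. *)
Definition slp_init : seq A := 1 :: 0 :: [seq 'X_i | i <- enum 'I_(hom_nvars G H)].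

Lemma slp_init_slp sk : slp sk slp_init.
Proof.
apply: slp_leaves; rewrite /= leaf1 leaf0 /=.
by apply/allP => _ /mapP[i _ ->]; apply: leafX.
Qed.

Lemma size_slp_init : size slp_init = (hom_nvars G H).+2.
Proof. by rewrite /= size_map size_enum_ord. Qed.

Lemma slp_init_X i : 'X_i \in slp_init.
Proof.
rewrite !inE; apply/orP; right; apply/orP; right.
by apply/mapP; exists i; rewrite ?mem_enum.
Qed.

Section Order.
Variables (t : nat) (B : 'I_t -> {set 'I_n}).
Hypothesis cover_bag : forall v, exists i, v \in B i.
Hypothesis cover_edge : forall u v, adj u v -> exists i, (u \in B i) && (v \in B i).

Lemma hom_factors_share F : F \in hom_factors ->
  [/\ depends_on F.1 F.2, {in F.1 &, forall x y, share B x y} &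
      forall phi, F.2 phi \in slp_init /\ leaf (F.2 phi)].
Proof.
move: F; apply: hom_factorsP => [u|u v Euv]; split=> /=.
- by move=> phi psi e; rewrite !ffunE e ?inE.
- by move=> x y /set1P-> /set1P->; apply: share_refl.
- by move=> phi; rewrite ffunE slp_init_X leafX.
- by move=> phi psi e; rewrite !ffunE !e // !inE eqxx ?orbT.
- have [i /andP[ui vi]] := cover_edge Euv.
  by move=> x y /set2P[]-> /set2P[]->; apply/existsP; exists i; rewrite ?ui ?vi.
move=> phi; rewrite ffunE; case: ifP => _; first by rewrite slp_init_X leafX.
by rewrite leaf0 !inE eqxx orbT.
Qed.

End Order.

(** Initial program, [n] elimination steps and a final product; [M] bounds the number of local
    factors plus the number of vertices. *)
Definition hom_cost w : nat :=
  let M := (n + n * n + n)%N in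
  ((hom_nvars G H).+2 + n * (k ^ w.+1 * (k * M + k.+1)) + M)%N.

Lemma hom_cost_gt0 w : (0 < hom_cost w)%N.
Proof. by []. Qed.

Lemma size_full_order (r : seq 'I_n) : uniq r -> r =i predT -> size r = n.
Proof. by move=> ur rT; rewrite -(card_uniqP ur) (eq_card rT) card_ord. Qed.

Lemma tw_circuit w : tw_le G w -> exists C : seq (gate R (hom_nvars G H)),
  (size C <= hom_cost w)%N /\ computes C (hom_poly R G H).
Proof.
case=> t [T [B [[_ Tsym _ _ Tacyc] [coverV coverE conn width]]]].
have [/hom_poly_const[c ->]|k0] := eqVneq k 0%N.
  by exists [:: GConst _ c]; rewrite hom_cost_gt0.
have a0 : 'I_k by exists 0%N; rewrite lt0n.
have [r [ur rT Er]] := tree_elim_order coverV width Tsym Tacyc conn [set: 'I_n].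
have {}rT : r =i predT by move=> x; rewrite rT inE.
have [||s [ss sz fs]] := slp_elim_order a0 (M := (n + n * n + n)%N) (Fs := hom_factors)
  [ffun=> a0] ur Er (slp_init_slp false) (mem_head _ _).
- move=> F /(hom_factors_share coverV coverE)[Fd Fcl Fs]; split=> //.
    by apply/subsetP => u _; rewrite inE rT.
  by move=> psi; have [] := Fs psi.
- by rewrite size_full_order // leq_add2r size_hom_factors.
(* The order lists every vertex, so the iterated sum is the full sum from any base assignment. *)
move: fs; rewrite sumouts_full // -hom_polyE => /(slp_circuit ss)[C [szC _ fC]].
exists C; split=> //; apply: leq_trans szC _; move: sz.
by rewrite size_slp_init size_full_order // card_ord.
Qed.

Lemma pw_circuit w : pw_le G w -> exists C : seq (gate R (hom_nvars G H)),
  [/\ (size C <= hom_cost w)%N, skew_circuit C & computes C (hom_poly R G H)].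
Proof.
case=> t [B [coverV coverE conn width]].
have [/hom_poly_const[c ->]|k0] := eqVneq k 0%N.
  by exists [:: GConst _ c]; rewrite hom_cost_gt0.
have a0 : 'I_k by exists 0%N; rewrite lt0n.
have [r [ur rT Er]] := path_elim_order coverV width conn.
(* The accumulator starts as the constant 1 with empty scope. *)
have [|||||s [ss sz fs]] := slp_linear_elim_order a0 (M := (n + n * n + n)%N)
  (q := fun=> 1) (Fs := hom_factors) [ffun=> a0] ur Er (slp_init_slp true).
- by move=> psi; rewrite mem_head.
- by [].
- exact: sub0set.
- move=> F /(hom_factors_share coverV coverE)[Fd Fcl Fs]; split=> //.
  by apply/subsetP => u _; rewrite inE rT.
- by rewrite (leq_trans size_hom_factors) // leq_addr.
move: fs; rewrite sumouts_full //; under eq_bigr do rewrite mulr1.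
rewrite -hom_polyE => /(slp_circuit ss)[C [szC skC fC]].
exists C; split=> //; last exact: skC.
apply: leq_trans szC _; move: sz.
by rewrite size_slp_init size_full_order // card_ord.
Qed.

End HomPoly.

(** * Polynomial size and degree bounds, and membership in VP and VBP *)

Section Bounds.
Variables (R : comNzRingType) (G H : nat -> sgraph).
Hypothesis pG : poly_bounded (fun m => nv (G m)).
Hypothesis pH : poly_bounded (fun m => nv (H m)).

Lemma poly_bounded_hom_nvars : poly_bounded (fun m => hom_nvars (G m) (H m)).
Proof. by apply: poly_boundedD; apply: poly_boundedM. Qed.

Lemma poly_bounded_hom_cost w : poly_bounded (fun m => hom_cost (G m) (H m) w).
Proof.
have pS g : poly_bounded g -> poly_bounded (fun m => (g m).+1).
  move=> pg; apply: poly_bounded_le (poly_boundedD pg (poly_bounded_const 1)) => m.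
  by rewrite addn1.
have pM : poly_bounded (fun m => nv (G m) + nv (G m) * nv (G m) + nv (G m))%N.
  by do 2![apply: poly_boundedD => //]; apply: poly_boundedM.
apply: poly_boundedD => //; apply: poly_boundedD.
  by do 2!apply: (pS); apply: poly_bounded_hom_nvars.
apply: poly_boundedM => //; apply: poly_boundedM; first exact: poly_boundedX.
by apply: poly_boundedD; [apply: poly_boundedM | apply: pS].
Qed.

Lemma hom_poly_p_family :
  p_family (fun m => hom_poly R (G m) (H m)).
Proof.
split; first exact: poly_bounded_hom_nvars.
apply: poly_bounded_le (fun m => msize_hom_poly R (G m) (H m)) _.
apply: poly_boundedD; first exact: poly_bounded_const.
apply: poly_boundedM; first exact: poly_bounded_const.
by apply: poly_boundedD => //; apply: poly_boundedM.
Qed.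

End Bounds.

Theorem theorem3 (F : fieldType) (G H : nat -> sgraph)
  (pG : poly_bounded (fun m => nv (G m)))
  (pH : poly_bounded (fun m => nv (H m)))
  (cH : forall m, is_complete (H m)) :
  (bounded_tw G ->
     @in_VP F (fun m => hom_nvars (G m) (H m)) (fun m => hom_poly F (G m) (H m))) /\
  (bounded_pw G ->
     @in_VBP F (fun m => hom_nvars (G m) (H m)) (fun m => hom_poly F (G m) (H m))).
Proof.
split=> -[w Gw]; split; try exact: hom_poly_p_family.
  have [c cost_le] := poly_bounded_hom_cost pG pH w; exists c => m.
  have [C [szC fC]] := tw_circuit F (H m) (Gw m).
  by exists C; split=> //; apply: leq_trans szC (cost_le m).
have [c cost_le] := poly_bounded_hom_cost pG pH w; exists c => m.
have [C [szC skC fC]] := pw_circuit F (H m) (Gw m).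
by exists C; split=> //; apply: leq_trans szC (cost_le m).
Qed.
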